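(* Let $\gamma>1$ and for each $n\in\mathbb{N}$ let $G_n$ be a graph of size $n$ generated by the Erased Configuration Model whose degrees are sampled from a regularly varying distribution with exponent $\gamma$, i.e. $\mathbb{P}(D>k)=L(k)k^{-\gamma}$ with $L$ slowly varying. Let $L_n=\sum_{i=1}^n D_i$ be the sum of the degrees and let $E_{ij}^c$ be the number of edges between nodes $i$ and $j$ removed by the model. Then $$\frac{1}{L_n}\sum_{i,j=1}^n \mathbb{E}_n\left[E_{ij}^c\right]=\begin{cases} O_{\mathbb{P}}\left(n^{\frac{1}{\gamma}-1}\right) & \text{if } 1<\gamma\le \frac32,\\ O_{\mathbb{P}}\left(n^{\frac{4}{\gamma}-3}\right) & \text{if } \frac32<\gamma\le 2,\\ O_{\mathbb{P}}\left(n^{-1}\right) & \text{if } \gamma>2.\end{cases}$$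
   Context: Degree distribution: $D$ is a non-negative integer-valued random variable with $\mathbb{P}(D>k)=L(k)k^{-\gamma}$, $\gamma>1$, where $L$ is slowly varying, i.e. $\lim_{x\to\infty}L(tx)/L(x)=1$ for all $t>0$. The degree sequence $\mathbf{D}_n=(D_1,\dots,D_n)$ consists of i.i.d. samples of $D$, except that if their sum is odd, $D_n$ is increased by one so that $L_n=\sum_{i=1}^n D_i$ is even. Configuration Model (CM): given $\mathbf{D}_n$, node $i$ receives $D_i$ stubs (half-edges), and the $L_n$ stubs are paired uniformly at random to form edges, giving a multigraph on $\{1,\dots,n\}$ that may have self-loops and multiple edges. $E_{ij}$ denotes the number of edges between $i$ and $j$ in this multigraph ($E_{ii}$ is the number of self-loops at $i$). Erased Configuration Model (ECM): after the pairing of the CM, self-loops are removed and multiple edges between a pair of nodes are merged into one edge. $E_{ij}^c$ is the number of edges between $i$ and $j$ so removed: $E_{ij}^c=E_{ij}-\mathbf{1}_{\{E_{ij}>0\}}$ for $i\ne j$, and $E_{ii}^c=E_{ii}$. $\mathbb{E}_n$ denotes expectation conditional on the degree sequence $\mathbf{D}_n$. Expressions with factor $1/L_n$ are taken to be $0$ on the event $L_n=0$ (whose probability tends to $0$). Probabilistic big-O: for random variables $(X_n)_{n\in\mathbb{N}}$ and $\rho\in\mathbb{R}$, $X_n=O_{\mathbb{P}}(n^\rho)$ means that for all $\varepsilon>0$, $n^{-\rho-\varepsilon}X_n\to 0$ in probability as $n\to\infty$. (This is not the usual tightness notion.) *)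

(* Defs.v *)
From mathcomp Require Import all_boot all_order all_algebra.
From mathcomp Require Import all_classical all_reals all_analysis.

Set Implicit Arguments.
Unset Strict Implicit.
Unset Printing Implicit Defensive.

Import Order.TTheory GRing.Theory Num.Theory.
Import numFieldNormedType.Exports.

Local Open Scope classical_set_scope.
Local Open Scope ring_scope.

Definition slowly_varying (R : realType) (L : R -> R) : Prop :=
  forall t : R, 0 < t -> L (t * x) / L x @[x --> +oo] --> (1 : R).

Section ConfigurationModel.
Local Open Scope nat_scope.
Local Open Scope set_scope.
Variable n : nat.

Definition degree_sum (d : {ffun 'I_n -> nat}) : nat := \sum_(i < n) d i.

(* The last node has index n.-1, i.e. i.+1 == n. *)
Definition parity_fix (x : {ffun 'I_n -> nat}) : {ffun 'I_n -> nat} :=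
  [ffun i : 'I_n => x i + (odd (degree_sum x) && (i.+1 == n))].

Definition stub (d : {ffun 'I_n -> nat}) := {i : 'I_n & 'I_(d i)}.

Definition is_pairing (d : {ffun 'I_n -> nat}) (M : {set {set stub d}}) :=
  finset.partition M [set: stub d] && [forall e in M, #|e| == 2].

Definition pairing (d : {ffun 'I_n -> nat}) :=
  {M : {set {set stub d}} | is_pairing M}.

(* An outcome of the model: a degree sequence with a pairing of its stubs. *)
Definition configuration := {d : {ffun 'I_n -> nat} & pairing d}.

Definition degrees (c : configuration) : {ffun 'I_n -> nat} := tag c.

(* Edges are counted as blocks of the pairing, so every self-loop at i counts
   exactly once in [edges c i i]. *)
Definition edges (c : configuration) (i j : 'I_n) : nat :=
  #|[set e in val (tagged c) |
      [exists x, exists y,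
        [&& x != y, e == [set x; y], tag x == i & tag y == j]]]|.

Definition erased_adj (c : configuration) (i j : 'I_n) : bool :=
  (i != j) && (0 < edges c i j).

Definition removed_edges (c : configuration) (i j : 'I_n) : nat :=
  edges c i j - erased_adj c i j.

End ConfigurationModel.

Section Probability.
Context {d0 d : measure_display} {T0 : measurableType d0} {T : measurableType d}.
Context {R : realType}.

(* As the A i range over all sets, setT included, the product rule for the full
   family contains the product rule for every subfamily. *)
Definition mutually_independent (P : probability T R) (n : nat)
    (X : 'I_n -> {RV P >-> nat}) : Prop :=
  forall A : 'I_n -> set nat,
    P (\bigcap_(i in [set: 'I_n]) (X i @^-1` A i)) =
    (\prod_(i < n) P (X i @^-1` A i))%E.

Definition iid_copies (P0 : probability T0 R) (D : {RV P0 >-> nat})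
    (P : probability T R) (n : nat) (X : 'I_n -> {RV P >-> nat}) : Prop :=
  mutually_independent X /\
  forall (i : 'I_n) (A : set nat), distribution P (X i) A = distribution P0 D A.

(* X is the family of i.i.d. samples and G the pairing of stubs; as the set of
   configurations is countable, measurability of G is stated on its points. *)
Record configuration_model (P0 : probability T0 R) (D : {RV P0 >-> nat})
    (P : probability T R) (n : nat) (X : 'I_n -> {RV P >-> nat})
    (G : T -> configuration n) : Prop := {
  cm_iid : iid_copies D X ;
  cm_degrees : forall w, degrees (G w) = parity_fix [ffun i => X i w] ;
  cm_measurable : forall c, measurable (G @^-1` [set c]) ;
  cm_uniform : forall c,
    P (G @^-1` [set c]) =
    (P [set w | degrees (G w) = degrees c] *
     (#|{: pairing (degrees c)}|%:R^-1)%:E)%E }.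

(* Conditional expectation given a random element Y with countable range:
   E[f | Y](w) = E[f ; Y = Y w] / P(Y = Y w). *)
Definition cond_expectation (P : probability T R) (S : Type) (Y : T -> S)
    (f : T -> R) (w : T) : R :=
  fine (\int[P]_(x in [set x | Y x = Y w]) (f x)%:E) /
  fine (P [set x | Y x = Y w]).

(* The normalized number of erased edges; it is 0 when the degree sum is 0,
   since 0^-1 = 0. *)
Definition mean_removed (P : probability T R) (n : nat)
    (G : T -> configuration n) (w : T) : R :=
  (degree_sum (degrees (G w)))%:R^-1 *
  \sum_(i < n) \sum_(j < n)
     cond_expectation P (fun x => degrees (G x))
       (fun x => (removed_edges (G x) i j)%:R) w.

End Probability.

(* The n-th random variable may live on its own probability space. *)
Definition cvg_prob0 (R : realType) (d : nat -> measure_display)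
    (T : forall n, measurableType (d n)) (P : forall n, probability (T n) R)
    (Y : forall n, T n -> R) : Prop :=
  forall delta : R, 0 < delta ->
    P n [set w | delta < `|Y n w|] @[n --> \oo] --> (0 : \bar R)%E.

(* For every positive epsilon, n^(-rho-epsilon) Y_n tends to 0 in probability;
   this is weaker than tightness of n^(-rho) Y_n. *)
Definition bigO_prob (R : realType) (d : nat -> measure_display)
    (T : forall n, measurableType (d n)) (P : forall n, probability (T n) R)
    (Y : forall n, T n -> R) (rho : R) : Prop :=
  forall eps : R, 0 < eps ->
    cvg_prob0 P (fun n w => (n%:R : R) `^ (- rho - eps) * Y n w).

(* Main.v *)
(* For s in [1, 2] with s < gamma, E[(D + 1)^s] is finite, and everything follows
   from the single bound n^(1 - s) up to arbitrarily small powers of n.  Given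
   the degrees d, of sum l, a given pair of stubs is matched with probability
   1/(l-1), and two disjoint pairs with probability 1/((l-1)(l-3)); hence, with
   a = d_i d_j / l, the mean number of removed edges between i <> j is at most
   min(2 a, 8 a^2) <= 8 a^s, and the mean number of self-loops at i is at most
   2 d_i^2 / l <= 2 d_i^s l^(1-s).  Summing gives
   2 S l^(-s) + 8 S^2 l^(-1-s) with S = sum_i d_i^s.  By Markov's inequality
   S <= n^(1+eta) with high probability, and l >= c n by Chernoff's bound on the
   number of nodes of positive degree.  One takes s = 2 if gamma > 2, and s
   slightly below gamma otherwise: 1 - gamma is at most both 1/gamma - 1 and
   4/gamma - 3. *)
Require Import Defs.
From mathcomp Require Import all_boot all_order all_algebra fingroup perm.
From mathcomp Require Import all_classical all_reals all_analysis.
From mathcomp Require Import measurable_realfun lra ring.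

Set Implicit Arguments.
Unset Strict Implicit.
Unset Printing Implicit Defensive.

Import Order.TTheory GRing.Theory Num.Theory.
Import numFieldNormedType.Exports.

Local Open Scope classical_set_scope.
Local Open Scope ring_scope.

(** * Counting perfect matchings with prescribed edges *)

Section PerfectMatchings.
Local Open Scope nat_scope.
Local Open Scope set_scope.
Variable S : finType.
Implicit Types (M : {set {set S}}) (Q : {set {set {set S}}}) (s : {perm S}).

Definition perfect_matching M :=
  finset.partition M [set: S] && [forall e in M, #|e| == 2].

Definition relabel s M : {set {set S}} := [set s @: (e : {set S}) | e in M].

Lemma relabel_inj s : injective (relabel s).
Proof. by apply: imset_inj; apply: imset_inj; apply: perm_inj. Qed.

Lemma mem_relabel s M (x y : S) :
  ([set s x; s y] \in relabel s M) = ([set x; y] \in M).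
Proof.
have -> : [set s x; s y] = s @: [set x; y] by rewrite imsetU1 imset_set1.
by rewrite mem_imset //; apply: imset_inj; apply: perm_inj.
Qed.

Lemma relabel_perfect_matching s M :
  perfect_matching M -> perfect_matching (relabel s M).
Proof.
have sinj := @perm_inj _ s.
move=> /andP[pM /forall_inP M2]; apply/andP; split; last first.
  apply/forall_inP => _ /imsetP[e eM ->]; rewrite card_imset //; exact: M2.
suff <- : s @: [set: S] = [set: S] by rewrite (imset_partition _ _ sinj).
by apply/finset.setP => x; rewrite inE -[x](permKV s) imset_f.
Qed.

Lemma perfect_matching_partner M (x y z : S) : perfect_matching M ->
  [set x; y] \in M -> [set x; z] \in M -> y = z.
Proof.
move=> /andP[/and3P[_ tM _] /forall_inP M2] xyM xzM.
have exy : [set x; y] = [set x; z].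
  apply/eqP; apply: contraT => ne.
  by have := disjointFr (finset.trivIsetP tM _ _ xyM xzM ne) (set21 x y); rewrite set21.
have := M2 _ xyM; rewrite cards2; have [//|xy _] := eqVneq x y.
have : y \in [set x; z] by rewrite -exy !inE eqxx orbT.
by rewrite !inE eq_sym (negbTE xy) => /eqP.
Qed.

Lemma card_set_in (T : finType) (A : {set T}) (p : pred T) :
  #|[set x in A | p x]| = \sum_(x in A) p x.
Proof.
rewrite -sum1dep_card big_mkcondr; apply: eq_bigr => x _; by case: (p x).
Qed.

(* Swapping w and v injects the matchings of Q containing {z, w} into those
   containing {z, v}, and a matching contains {z, v} for at most one v in W. *)
Lemma card_matchings_edge (Q : {set {set {set S}}}) (W : {set S}) (z w : S) :
  (forall M, M \in Q -> perfect_matching M) ->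
  (forall v v' M, v \in W -> v' \in W -> M \in Q -> relabel (tperm v v') M \in Q) ->
  z \notin W -> w \in W ->
  #|W| * #|[set M in Q | [set z; w] \in M]| <= #|Q|.
Proof.
move=> Qpm QW zW wW.
have -> : #|W| * #|[set M in Q | [set z; w] \in M]| =
          \sum_(v in W) #|[set M in Q | [set z; w] \in M]| by rewrite sum_nat_const.
have le v : v \in W -> #|[set M in Q | [set z; w] \in M]| <=
    #|[set M in Q | [set z; v] \in M]|.
  move=> vW; rewrite -(card_imset _ (@relabel_inj (tperm w v))).
  apply/subset_leq_card/fintype.subsetP => N /imsetP[M].
  rewrite inE => /andP[MQ zwM] ->.
  rewrite inE QW //=.
  have zt : tperm w v z = z.
    by rewrite tpermD //; apply: contraNneq zW => <-.
  by rewrite -{1}(tpermL w v) -{1}zt mem_relabel.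
apply: (@leq_trans (\sum_(v in W) #|[set M in Q | [set z; v] \in M]|)).
  exact: leq_sum.
rewrite -[leqRHS]sum1_card.
rewrite (eq_bigr _ (fun v _ => card_set_in Q (fun M => [set z; v] \in M))).
rewrite exchange_big /=; apply: leq_sum => M MQ; rewrite -card_set_in.
have [|/set0Pn] := eqVneq [set v in W | [set z; v] \in M] finset.set0.
  by move=> ->; rewrite cards0.
move=> [v]; rewrite inE => /andP[vW vM].
rewrite -(cards1 v); apply/subset_leq_card/fintype.subsetP => u; rewrite !inE.
move=> /andP[_ uM]; apply/eqP; exact: (perfect_matching_partner (Qpm _ MQ) uM vM).
Qed.

Definition matchings : {set {set {set S}}} := [set M | perfect_matching M].

(** By symmetry each of the [#|S| - 1] points other than [x] is equally likely to be its partner.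
    The product form avoids division in [nat]. *)
Lemma card_matchings_edge1 (x y : S) : x != y ->
  (#|S| - 1) * #|[set M in matchings | [set x; y] \in M]| <= #|matchings|.
Proof.
move=> xy; have -> : #|S| - 1 = #|[set~ x]| by rewrite cardsC1 subn1.
apply: card_matchings_edge; rewrite ?inE ?eqxx 1?eq_sym //.
- by move=> M; rewrite inE.
- by move=> v v' M _ _; rewrite !inE; apply: relabel_perfect_matching.
Qed.

(** Among the matchings containing {x, y}, the partner of [z] ranges over the [#|S| - 3] points
    outside {x, y, z}; transpositions of such points fix [x] and [y], so they preserve this
    family. *)
Lemma card_matchings_edge2 (x y z w : S) : uniq [:: x; y; z; w] ->
  (#|S| - 1) * (#|S| - 3) *
    #|[set M in matchings | ([set x; y] \in M) && ([set z; w] \in M)]|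
  <= #|matchings|.
Proof.
move=> /=; rewrite !inE !negb_or => /and4P[/and3P[xy xz xw] /andP[yz yw] zw _].
apply: leq_trans (card_matchings_edge1 xy); rewrite -mulnA leq_mul2l; apply/orP; right.
have -> : #|S| - 3 = #|~: [set x; y; z]|.
  rewrite cardsCs finset.setCK -(finset.setUC [set z]) cardsU1 cards2 !inE xy eq_sym (negbTE xz).
  by rewrite eq_sym (negbTE yz) /= .
set Q := [set M in matchings | [set x; y] \in M].
have -> : [set M in matchings | ([set x; y] \in M) && ([set z; w] \in M)] =
          [set M in Q | [set z; w] \in M] by apply/finset.setP => M; rewrite !inE andbA.
apply: card_matchings_edge.
- by move=> M; rewrite !inE => /andP[].
- move=> v v' M; rewrite !inE !negb_or => /andP[/andP[vx vy] _] /andP[/andP[v'x v'y] _].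
  move=> /andP[Mpm xyM]; rewrite relabel_perfect_matching //=.
  by rewrite -[x](tpermD vx v'x) -[y](tpermD vy v'y) mem_relabel.
- by rewrite !inE eqxx orbT.
- by rewrite !inE !negb_or !(eq_sym w) xw yw.
Qed.

End PerfectMatchings.

(** * First and second moment counts for edges between two nodes *)

Section StubPairings.
Local Open Scope nat_scope.
Local Open Scope set_scope.
Variables (n : nat) (d : {ffun 'I_n -> nat}).

Definition stubs_at (i : 'I_n) : {set stub d} := [set x | tag x == i].

Lemma card_stub : #|{: stub d}| = degree_sum d.
Proof. by rewrite card_tagged sumnE big_map big_enum; under eq_bigr do rewrite card_ord. Qed.

Lemma card_stubs_at (i : 'I_n) : #|stubs_at i| = d i.
Proof.
have -> : stubs_at i = (fun k : 'I_(d i) => existT _ i k : stub d) @: [set: 'I_(d i)].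
  apply/finset.setP => -[j k]; rewrite !inE /=; apply/eqP/imsetP => [ji|[k' _ /(congr1 tag)//]].
    by move: ji k => -> k; exists k; rewrite ?inE.
by rewrite card_imset ?cardsT ?card_ord // => k k' /eqP; rewrite eq_Tagged => /eqP.
Qed.

Lemma sum_pairing (f : {set {set stub d}} -> nat) :
  \sum_(M : pairing d) f (val M) = \sum_(M in matchings (stub d)) f M.
Proof.
rewrite (reindex_omap (val : pairing d -> _) insub) => [|M]; last first.
  by rewrite inE => Mpm; rewrite insubT.
by apply: eq_bigl => -[M Mpm]; rewrite inE /= insubT /= eqxx andbT.
Qed.

Lemma card_pairing : #|{: pairing d}| = #|matchings (stub d)|.
Proof. by rewrite -!sum1_card; exact: (sum_pairing (fun=> 1)). Qed.

Definition conf (M : pairing d) : configuration n := existT _ d M.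

(* The ordered pairs make this count a self-loop twice. *)
Definition links (i j : 'I_n) (M : {set {set stub d}}) : {set stub d * stub d} :=
  [set p in finset.setX (stubs_at i) (stubs_at j) | (p.1 != p.2) && ([set p.1; p.2] \in M)].

Lemma edges_le_links (M : pairing d) (i j : 'I_n) :
  edges (conf M) i j <= #|links i j (val M)|.
Proof.
apply: leq_trans (leq_imset_card (fun p => [set p.1; p.2]) _).
apply/subset_leq_card/fintype.subsetP => e; rewrite inE => /andP[eM].
case/existsP => x /existsP[y /and4P[xy /eqP ee tx ty]].
by apply/imsetP; exists (x, y); rewrite // !inE /= tx ty xy -ee.
Qed.

(** Exchanging the sums leaves one count per ordered pair of stubs, bounded by
    [card_matchings_edge1]. The case [i = j] is included and serves for self-loops. *)
Lemma sum_edges_le (i j : 'I_n) :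
  (degree_sum d - 1) * \sum_(M : pairing d) edges (conf M) i j
  <= d i * d j * #|{: pairing d}|.
Proof.
apply: (@leq_trans ((degree_sum d - 1) * \sum_(M : pairing d) #|links i j (val M)|)).
  by rewrite leq_mul2l leq_sum ?orbT // => M _; exact: edges_le_links.
rewrite (sum_pairing (fun M => #|links i j M|)) card_pairing -card_stub.
rewrite -(card_stubs_at i) -(card_stubs_at j) -cardsX.
under eq_bigr do rewrite card_set_in.
rewrite exchange_big /= big_distrr /= -sum_nat_const.
apply: leq_sum => -[x y] _ /=; have [->|xy] := eqVneq x y.
  by rewrite big1 ?muln0.
by apply: leq_trans (card_matchings_edge1 xy); rewrite leq_mul2l card_set_in leqnn orbT.
Qed.

(** Removed edges are dominated by ordered pairs of distinct edges. There are at most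
    [(d i * d j) ^ 2] candidate pairs, and each occurs in few matchings by
    [card_matchings_edge2]. *)
Lemma sum_removed_edges_le (i j : 'I_n) : i != j ->
  (degree_sum d - 1) * (degree_sum d - 3) *
    \sum_(M : pairing d) removed_edges (conf M) i j
  <= (d i * d j) ^ 2 * #|{: pairing d}|.
Proof.
move=> ij.
pose D := finset.setX (stubs_at i) (stubs_at j).
pose pairs (M : {set {set stub d}}) := \sum_(p in D) \sum_(q in D)
  [&& p != q, [set p.1; p.2] \in M & [set q.1; q.2] \in M].
(* e edges between i and j leave e - 1 <= e (e - 1) removed edges, and
   e (e - 1) counts ordered pairs of distinct edges. *)
have : \sum_(M : pairing d) removed_edges (conf M) i j <=
       \sum_(M : pairing d) pairs (val M).
  apply: leq_sum => M _.
  have : removed_edges (conf M) i j <= (#|links i j (val M)|).-1.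
    rewrite /removed_edges /erased_adj ij /=.
    have := edges_le_links M i j; case: (edges _ _ _) => [|e] //=.
    by rewrite subSS subn0; case: #|_|.
  move/leq_trans; apply.
  have D12 p : p \in D -> p.1 != p.2.
    by rewrite !inE => /andP[/eqP p1 /eqP p2]; apply: contraNneq ij => p12; rewrite -p1 -p2 p12.
  have linkE p : (p \in links i j (val M)) = (p \in D) && ([set p.1; p.2] \in val M).
    by rewrite finset.in_set -/D; case: (boolP (p \in D)) => // /D12 pp; rewrite pp.
  apply: (@leq_trans (\sum_(p in links i j (val M)) #|links i j (val M) :\ p|)).
    rewrite (eq_bigr (fun=> #|links i j (val M)|.-1)) => [|p pM]; last first.
      by rewrite (cardsD1 p (links _ _ _)) pM.
    by rewrite sum_nat_const; case: #|_| => // k; rewrite leq_pmull.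
  rewrite (eq_bigl _ _ linkE) big_mkcondr /=; apply: leq_sum => p pD.
  case: ifP => // pM; rewrite -sum1_card [leqLHS](eq_bigl (fun q => (q \in D) &&
    ((q != p) && ([set q.1; q.2] \in val M)))); last first.
    by move=> q; rewrite finset.in_setD1 linkE andbCA.
  rewrite big_mkcondr; apply: leq_sum => q qD /=; rewrite eq_sym.
  by case: ifP.
move/(leq_mul (leqnn ((degree_sum d - 1) * (degree_sum d - 3))))/leq_trans; apply.
rewrite (sum_pairing pairs) card_pairing -card_stub.
rewrite exchange_big /= big_distrr /=.
have -> : (d i * d j) ^ 2 * #|matchings (stub d)| =
    \sum_(p in D) \sum_(q in D) #|matchings (stub d)|.
  by rewrite !sum_nat_const cardsX !card_stubs_at mulnA mulnn.
apply: leq_sum => p pD; rewrite exchange_big big_distrr /=; apply: leq_sum => q qD.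
(* Four distinct stubs fall under the count for two edges; distinct pairs that share a stub never
   lie in a common matching. *)
have [u|nu] := boolP (uniq [:: p.1; p.2; q.1; q.2]).
  apply: leq_trans (card_matchings_edge2 u); rewrite leq_mul2l card_set_in.
  by apply/orP; right; apply: leq_sum => M _; case: (p != q).
rewrite big1 ?muln0 // => M; rewrite inE => Mpm.
apply/eqP; rewrite eqb0; apply: contra nu => /and3P[pq pM qM].
move: pD qD pq pM qM; case: p => x y; case: q => z w.
rewrite !inE /= => /andP[/eqP xi /eqP yj] /andP[/eqP zi /eqP wj] pq xyM zwM.
have ne (a b : stub d) : tag a = i -> tag b = j -> a != b.
  by move=> ai bj; apply: contraNneq ij => ab; rewrite -ai -bj ab.
rewrite !inE !negb_or ne //= (ne x w) // (eq_sym y) (ne z y) // (ne z w) // !andbT /=.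
(* As stubs at [i] and at [j] differ, only [x = z] and [y = w] remain to be excluded; either one
   makes the partners agree as well, hence [p = q]. *)
apply/andP; split; apply: contraNneq pq => e.
  have xwM : [set x; w] \in M by rewrite e.
  by rewrite (perfect_matching_partner Mpm xyM xwM) e.
have yxM : [set y; x] \in M by rewrite finset.setUC.
have yzM : [set y; z] \in M by rewrite e finset.setUC.
by rewrite (perfect_matching_partner Mpm yxM yzM) e.
Qed.

End StubPairings.

(** * Conditional expectation as an average over pairings *)

Section ConditionalExpectation.
Context {d0 : measure_display} {T : measurableType d0} {R : realType}.
Variables (P : probability T R) (n : nat) (G : T -> configuration n).
Hypothesis measurable_point : forall c, measurable (G @^-1` [set c]).
Hypothesis uniform_point : forall c,
  P (G @^-1` [set c]) = (P [set w | degrees (G w) = degrees c] *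
                         (#|{: pairing (degrees c)}|%:R^-1)%:E)%E.

Lemma degrees_fiber (d : {ffun 'I_n -> nat}) :
  [set x | degrees (G x) = d] =
  \bigcup_(M in [set: pairing d]) (G @^-1` [set conf M]).
Proof.
apply/seteqP; split=> [x <-|x [M _ /= ->]] //.
by exists (tagged (G x)) => //=; rewrite /conf /degrees; case: (G x).
Qed.

Lemma measurable_degrees_fiber (d : {ffun 'I_n -> nat}) :
  measurable [set x | degrees (G x) = d].
Proof.
rewrite degrees_fiber; apply: fin_bigcup_measurable => [|M _]; first exact: finite_finset.
exact: measurable_point.
Qed.

(** The factor [q / q] is 1 on a degree sequence of positive probability and 0 on a null one, where
    the conditional expectation is 0 by default. *)
Lemma cond_expectation_uniform (f : configuration n -> R) (w : T) :
  (forall c, 0 <= f c) ->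
  let q := fine (P [set x | degrees (G x) = degrees (G w)]) in
  cond_expectation P (fun x => degrees (G x)) (f \o G) w =
  q / q * ((\sum_(M : pairing (degrees (G w))) f (conf M)) /
           #|{: pairing (degrees (G w))}|%:R).
Proof.
move=> f0 q; set d := degrees (G w).
have mA := measurable_degrees_fiber d; set A := [set x | _] in mA.
rewrite /cond_expectation -/d -/A.
have -> : (\int[P]_(x in A) ((f \o G) x)%:E =
    \sum_(M : pairing d) (f (conf M))%:E * P (G @^-1` [set conf M]))%E.
  (* On the fibre, [f \o G] is a finite combination of indicators of single configurations, so its
     integral is a finite sum of point masses. *)
  transitivity (\int[P]_(x in A) (\sum_(M : pairing d)
      (f (conf M))%:E * (\1_(G @^-1` [set conf M]) x)%:E))%E.
    apply: eq_integral => x; rewrite inE => Ax.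
    have [M GxM] : exists M : pairing d, G x = conf M.
      by move: Ax; rewrite /A degrees_fiber => -[M _ /= ->]; exists M.
    rewrite (bigD1 M) //= big1 => [|N NM]; last first.
      rewrite indicE (_ : _ \in _ = false) ?mule0 //.
      apply/negbTE; apply: contra NM; rewrite inE /= GxM => e.
      by move/eqP: e; rewrite eq_Tagged eq_sym.
    by rewrite indicE mem_set ?mule1 ?adde0 /= ?GxM.
  rewrite ge0_integral_sum //; last 2 first.
  - move=> M; apply: measurable_funeM.
    by apply/measurable_EFinP/measurable_indic/measurable_point.
  - by move=> M x _; rewrite mule_ge0 ?lee_fin ?f0.
  apply: eq_bigr => M _; rewrite ge0_integralZl_EFin //; last first.
    by apply/measurable_EFinP/measurable_indic/measurable_point.
  rewrite integral_indic //.
  congr (_ * P _)%E; apply/setIidPl; rewrite /A degrees_fiber.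
  by move=> x Gx; exists M.
under eq_bigr do rewrite uniform_point /= -/d -/A.
have qE : P A = q%:E by rewrite fineK // fin_num_measure.
rewrite qE; under eq_bigr do rewrite -!EFinM.
by rewrite sumEFin /= -mulr_suml (mulrCA _ q) mulrAC.
Qed.

End ConditionalExpectation.

(** * Elementary inequalities behind the interpolation *)

Section Interpolation.
Context {R : realType}.

Lemma average_le (N c : nat) (S K : R) :
  c%:R * S <= K * N%:R -> 0 <= K -> (0 < c)%N -> S / N%:R <= K / c%:R.
Proof.
(* For [N = 0] the left side is 0, since 0 has inverse 0. *)
case: N => [|N] h K0 c0; first by rewrite invr0 mulr0 divr_ge0.
by rewrite ler_pdivrMr ?ltr0n // mulrAC ler_pdivlMr ?ltr0n // mulrC.
Qed.

(** For [a >= 1] the power s dominates the first power, for [a <= 1] it dominates the square. The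
    disjunction tells which of the two moment bounds to use. *)
Lemma powR_ge_minX (a s : R) : 0 <= a -> 1 <= s <= 2 ->
  2 * a <= 8 * a `^ s \/ 8 * a ^+ 2 <= 8 * a `^ s.
Proof.
rewrite le_eqVlt => /orP[/eqP <- _|a0 /andP[s1 s2]].
  by left; rewrite mulr0 mulr_ge0 // powR_ge0.
have [a1|/ltW a1] := leP 1 a.
  left; have := ler_powR a1 s1; rewrite powRr1 ?(ltW a0) // => h.
  by have := powR_ge0 a s; nra.
by right; rewrite ler_pM2l // -powR_mulrn ?(ltW a0) // ger_powR // a0.
Qed.

Lemma inv_pred_le (l : R) : 4 <= l -> (l - 1)^-1 <= 2 / l.
Proof.
move=> l4; have l0 : 0 < l by lra.
have l1 : 0 < l - 1 by lra.
by rewrite ler_pdivlMr // mulrC ler_pdivrMr //; lra.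
Qed.

(** The ratio of l^2 to (l - 1)(l - 3) decreases from 16/3 at l = 4, so 8 is enough. *)
Lemma inv_pred2_le (l : R) : 4 <= l -> ((l - 1) * (l - 3))^-1 <= 8 * l^-1 ^+ 2.
Proof.
move=> l4; have l0 : 0 < l ^+ 2 by nra.
have l1 : 0 < (l - 1) * (l - 3) by nra.
by rewrite exprVn ler_pdivlMr // mulrC ler_pdivrMr //; nra.
Qed.

End Interpolation.

(** * Bound on the mean number of removed edges for fixed degrees *)

Section MeanRemovedBound.
Context {d0 : measure_display} {T : measurableType d0} {R : realType}.
Variables (P : probability T R) (n : nat) (G : T -> configuration n).
Hypothesis measurable_point : forall c, measurable (G @^-1` [set c]).
Hypothesis uniform_point : forall c,
  P (G @^-1` [set c]) = (P [set w | degrees (G w) = degrees c] *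
                         (#|{: pairing (degrees c)}|%:R^-1)%:E)%E.
Variable w : T.
Let d := degrees (G w).
Let l : R := (degree_sum d)%:R.
Let mean (i j : 'I_n) : R := cond_expectation P (fun x => degrees (G x))
       (fun x => (removed_edges (G x) i j)%:R) w.
Let avg (f : configuration n -> nat) : R :=
  (\sum_(M : pairing d) f (conf M))%:R / #|{: pairing d}|%:R.

(** Equality holds on the right unless the degree sequence has probability 0, in which case the mean
    is 0 by default. *)
Lemma mean_removed_le_avg i j :
  0 <= mean i j <= avg (fun c => removed_edges c i j).
Proof.
rewrite /mean (cond_expectation_uniform measurable_point uniform_point
  (f := fun c => (removed_edges c i j)%:R)) // -/d -natr_sum -/(avg _).
set q := fine _; have [->|q0] := eqVneq q 0.
  by rewrite !mul0r lexx divr_ge0.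
by rewrite divff // mul1r lexx divr_ge0.
Qed.

Lemma mean_removed_ge0 : 0 <= mean_removed P G w.
Proof.
rewrite /mean_removed mulr_ge0 ?invr_ge0 //.
by apply: sumr_ge0 => i _; apply: sumr_ge0 => j _; case/andP: (mean_removed_le_avg i j).
Qed.

Hypothesis d4 : (4 <= degree_sum d)%N.

Let l4 : 4 <= l. Proof. by rewrite /l ler_nat. Qed.

Lemma mean_removed_le1 i j : mean i j <= 2 * ((d i)%:R * (d j)%:R / l).
Proof.
have /andP[_ /le_trans] := mean_removed_le_avg i j; apply.
have le : (\sum_(M : pairing d) removed_edges (conf M) i j <=
           \sum_(M : pairing d) edges (conf M) i j)%N.
  by apply: leq_sum => M _; exact: leq_subr.
have := sum_edges_le d i j.
move=> /(leq_trans (leq_mul (leqnn _) le)).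
rewrite -(ler_nat R) natrM [leRHS]natrM => /average_le.
have c0 : (0 < degree_sum d - 1)%N by rewrite subn_gt0; exact: leq_trans d4.
move=> /(_ (ler0n _ _) c0)/le_trans; apply.
rewrite natrM natrB ?(leq_trans _ d4) // -/l mulrCA ler_wpM2l ?mulr_ge0 //.
exact: inv_pred_le.
Qed.

Lemma mean_removed_le2 i j : i != j ->
  mean i j <= 8 * ((d i)%:R * (d j)%:R / l) ^+ 2.
Proof.
move=> ij.
have /andP[_ /le_trans] := mean_removed_le_avg i j; apply.
have := sum_removed_edges_le d ij.
rewrite -(ler_nat R) natrM [leRHS]natrM => /average_le.
have c0 : (0 < (degree_sum d - 1) * (degree_sum d - 3))%N.
  by rewrite muln_gt0 !subn_gt0 (leq_trans _ d4) // (leq_trans _ d4).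
move=> /(_ (ler0n _ _) c0)/le_trans; apply.
rewrite natrX !natrM !natrB ?(leq_trans _ d4) // -/l [X in _ <= 8 * X]exprMn [leRHS]mulrCA.
rewrite ler_wpM2l ?sqr_ge0 //; exact: inv_pred2_le.
Qed.

Variable s : R.
Hypothesis s12 : 1 <= s <= 2.
Let S : R := \sum_(i < n) (d i)%:R `^ s.

Lemma mean_removed_le_powR i j : mean i j <=
  2 * (l `^ (1 - s)) * (d i)%:R `^ s *+ (i == j) +
  8 * (l `^ (- s)) * ((d i)%:R `^ s * (d j)%:R `^ s).
Proof.
have [s1 s2] := andP s12.
have [<-|ij] := eqVneq i j; last first.
  have -> : 8 * l `^ (- s) * ((d i)%:R `^ s * (d j)%:R `^ s) =
            8 * ((d i)%:R * (d j)%:R / l) `^ s.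
    rewrite !powRM ?mulr_ge0 ?invr_ge0 // -[l^-1]powR_inv1 // -powRrM mulN1r.
    by rewrite -!mulrA; congr (_ * _); rewrite mulrC mulrA.
  rewrite mulr0n add0r.
  have : 0 <= (d i)%:R * (d j)%:R / l :> R by rewrite divr_ge0 ?mulr_ge0.
  move/(powR_ge_minX (s := s))/(_ s12).
  by case; apply: le_trans; [exact: mean_removed_le1|exact: mean_removed_le2].
have l0 : 0 < l by have := l4; lra.
rewrite mulr1n -[leLHS]addr0 lerD //; last by rewrite !mulr_ge0 ?powR_ge0.
apply: (le_trans (mean_removed_le1 _ _)).
rewrite -[leRHS]mulrA ler_pM2l //.
(* On the diagonal, [d i <= l] turns the factor of exponent [2 - s >= 0] into a power of [l]. The
   exponents add up to 2, not 0, so the identity also holds for [d i = 0]. *)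
have -> : (d i)%:R * (d i)%:R = (d i)%:R `^ s * (d i)%:R `^ (2 - s) :> R.
  rewrite -powRD; last by rewrite addrC subrK pnatr_eq0.
  by rewrite addrC subrK powR_mulrn // expr2.
rewrite -mulrA [leRHS]mulrC ler_wpM2l ?powR_ge0 //.
have -> : l `^ (1 - s) = l `^ (2 - s) / l.
  rewrite -[l^-1]powR_inv1 ?ltW // -powRD ?(gt_eqF l0) ?implybT //.
  by congr (_ `^ _); lra.
rewrite ler_pM2r ?invr_gt0 // ge0_ler_powR ?nnegrE ?subr_ge0 //.
by rewrite ler_nat /degree_sum (bigD1 i) //= leq_addr.
Qed.

Lemma mean_removed_le : mean_removed P G w <=
  l^-1 * (2 * l `^ (1 - s) * S + 8 * l `^ (- s) * S ^+ 2).
Proof.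
rewrite /mean_removed ler_wpM2l ?invr_ge0 //.
have le i j := mean_removed_le_powR i j.
apply: le_trans (ler_sum _ (fun i _ => ler_sum _ (fun j _ => le i j))) _.
under eq_bigr do rewrite big_split /=.
rewrite big_split /= lerD //.
  rewrite mulr_sumr ler_sum // => i _.
  by rewrite (bigD1 i) //= eqxx big1 ?addr0 // => j; rewrite eq_sym => /negbTE ->.
rewrite expr2 mulr_suml mulr_sumr ler_sum // => i _.
by rewrite !mulr_sumr ler_sum // => j _; rewrite !mulrA.
Qed.

End MeanRemovedBound.

(** * Chernoff bound on the number of nodes of positive degree *)

Section DegreeSumLowerBound.
Context {d0 d : measure_display} {T0 : measurableType d0} {T : measurableType d}.
Context {R : realType}.
Variables (P0 : probability T0 R) (D : {RV P0 >-> nat}).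
Variables (P : probability T R) (n : nat) (X : 'I_n -> {RV P >-> nat}).
Hypothesis iidX : iid_copies D X.

Let p : R := fine (P0 (D @^-1` [set k | (0 < k)%N])).

Lemma measurable_RV_nat d' (T' : measurableType d') (P' : probability T' R)
  (Y : {RV P' >-> nat}) (B : set nat) : measurable (Y @^-1` B).
Proof. by rewrite -[_ @^-1` _]setTI; exact: measurable_funPT. Qed.

(** The random set itself is kept, not only its size: by independence its law is an explicit product
    over the nodes. *)
Definition positive_nodes (w : T) : {set 'I_n} := [set i | (0 < X i w)%N]%SET.

Lemma positive_nodes_fiber (A : {set 'I_n}) :
  positive_nodes @^-1` [set A] = \bigcap_(i in [set: 'I_n])
    (X i @^-1` [set k | (0 < k)%N = (i \in A)]).
Proof.
apply/seteqP; split=> w /=.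
  by move=> <- i _ /=; rewrite inE.
by move=> h; apply/finset.setP => i; rewrite inE; exact: h.
Qed.

Lemma measurable_positive_nodes_fiber (B : set {set 'I_n}) :
  measurable (positive_nodes @^-1` B).
Proof.
have -> : positive_nodes @^-1` B = \bigcup_(A in B) (positive_nodes @^-1` [set A]).
  by apply/seteqP; split=> [w Bw|w [A BA /= ->]] //; exists (positive_nodes w).
apply: fin_bigcup_measurable => [|A _]; first exact: finite_finset.
rewrite positive_nodes_fiber; apply: fin_bigcap_measurable => [|i _].
  exact: finite_finset.
exact: measurable_RV_nat.
Qed.

Lemma prob_positive_nodes (A : {set 'I_n}) : P (positive_nodes @^-1` [set A]) =
  (\prod_(i < n) (if i \in A then p else 1 - p))%:E.
Proof.
rewrite positive_nodes_fiber iidX.1 -prodEFin; apply: eq_bigr => i _.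
have /= := iidX.2 i [set k | (0 < k)%N = (i \in A)].
rewrite /distribution /pushforward => ->.
have pE : P0 (D @^-1` [set k | (0 < k)%N]) = p%:E.
  by rewrite fineK // fin_num_measure //; exact: measurable_RV_nat.
case: (i \in A) => //=.
rewrite EFinB -pE -probability_setC; last exact: measurable_RV_nat.
by congr (P0 _); apply/seteqP; split=> w /=; case: (D w).
Qed.

(** With N the number of positive nodes and t = n p / 4, the exponential Markov inequality bounds
    the probability by e^t E[e^(-N)], and E[e^(-N)] = (p/e + 1 - p)^n <= e^(-n p / 2). *)
Lemma prob_few_positive_nodes :
  (P [set w | (#|positive_nodes w|%:R <= n%:R * p / 4)%R] <=
   (expR (- (n%:R * p / 4)))%:E)%E.
Proof.
set t := n%:R * p / 4.
have p0 : 0 <= p by rewrite fine_ge0.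
have p1 : p <= 1.
  rewrite -lee_fin fineK ?fin_num_measure ?probability_le1 //; exact: measurable_RV_nat.
pose r := enum [pred A : {set 'I_n} | #|A|%:R <= t].
have -> : [set w | #|positive_nodes w|%:R <= t] =
    \bigcup_(A in [set` r]) (positive_nodes @^-1` [set A]).
  apply/seteqP; split=> [w Bw|w [A /= + /= ->]]; last by rewrite mem_enum.
  by exists (positive_nodes w) => //=; rewrite mem_enum.
rewrite measure_fin_bigcup //; last 2 first.
- by apply/trivIsetP => A B _ _ AB; apply/seteqP; split=> // w [/= -> /eqP]; apply/negP.
- by move=> A _; exact: measurable_positive_nodes_fiber.
rewrite -fsbig_seq ?enum_uniq // big_enum /=.
rewrite (eq_bigr _ (fun A _ => prob_positive_nodes A)) sumEFin lee_fin.
have e2 : expR (-1) <= 2^-1 :> R.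
  rewrite expRN lef_pV2 ?posrE ?expR_gt0 //.
  by apply: le_trans (expR_ge1Dx 1); lra.
(* [f A] is the probability of [A] times exp(t - #|A|), a weight of at least 1 when [#|A| <= t]; its
   sum over all subsets factorises by [bigA_distr]. *)
pose f (A : {set 'I_n}) := expR t * \prod_(i < n) (if i \in A then p * expR (-1) else 1 - p).
have f0 A : 0 <= f A.
  rewrite mulr_ge0 ?expR_ge0 // prodr_ge0 // => i _.
  by case: ifP => _; rewrite ?mulr_ge0 ?expR_ge0 // subr_ge0.
apply: (@le_trans _ _ (\sum_(A : {set 'I_n}) f A)).
  rewrite [leRHS](bigID [pred A : {set 'I_n} | #|A|%:R <= t]) /= -[leLHS]addr0.
  rewrite lerD ?sumr_ge0 // ler_sum // => A At; rewrite /f.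
  pose c i := if i \in A then p else 1 - p.
  have -> : \prod_(i < n) (if i \in A then p * expR (-1) else 1 - p) =
      \prod_(i < n) c i * expR (- #|A|%:R).
    rewrite -[#|A|%:R]mulr1 -mulrN expRM_natl -prodr_const [X in _ = _ * X]big_mkcond /=.
    by rewrite -big_split /=; apply: eq_bigr => i _; rewrite /c; case: ifP; rewrite ?mulr1.
  rewrite mulrCA -expRD -[leLHS]mulr1 ler_wpM2l //.
    by rewrite prodr_ge0 // => i _; rewrite /c; case: ifP => _ //; rewrite subr_ge0.
  by apply: le_trans (expR_ge1Dx _); rewrite lerDl subr_ge0.
have := @bigA_distr _ _ _ *%R +%R 'I_n (fun=> p * expR (-1)) (fun=> 1 - p).
rewrite -mulr_sumr => <-.
rewrite prodr_const card_ord.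
have le : p * expR (-1) + (1 - p) <= expR (- p / 2).
  by apply: le_trans (expR_ge1Dx _); nra.
apply: (@le_trans _ _ (expR t * expR (- p / 2) ^+ n)).
  rewrite ler_wpM2l ?expR_ge0 // lerXn2r ?nnegrE ?expR_ge0 //.
  by rewrite addr_ge0 ?mulr_ge0 ?expR_ge0 // subr_ge0.
rewrite -expRM_natl -expRD ler_expR /t; lra.
Qed.

End DegreeSumLowerBound.

(** * Tail decay and finite moments of the degree distribution *)

Section Moments.
Context {R : realType} {d0 : measure_display} {T0 : measurableType d0}.
Variables (P0 : probability T0 R) (D : {RV P0 >-> nat}).
Variables (L : R -> R) (gamma : R).
Hypothesis hL : slowly_varying L.
Hypothesis hD : forall k : nat, (0 < k)%N ->
  P0 [set w | (k < D w)%N] = (L k%:R * k%:R `^ (- gamma))%:E.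

(** Induction on [N] shifts the sequence by one and absorbs its first term into the constant. *)
Lemma geometric_domination (u : nat -> R) (r : R) (N : nat) : 0 < r ->
  (forall m, 0 <= u m) -> (forall m, (N <= m)%N -> u m.+1 <= r * u m) ->
  exists2 C, 0 <= C & forall m, u m <= C * r ^+ m.
Proof.
move=> r0; elim: N u => [|N ih] u u0 ur.
  exists (u 0%N) => //; elim=> [|m le]; first by rewrite mulr1.
  by apply: le_trans (ur _ _) _ => //; rewrite exprS mulrCA ler_pM2l.
have [||C C0 le] := ih (fun m => u m.+1) => //.
  by move=> m Nm; exact: ur.
exists (Num.max (u 0%N) (C / r)) => [|[|m]]; first by rewrite le_max u0.
- by rewrite mulr1 le_max lexx.
- apply: le_trans (le m) _; rewrite exprS mulrA ler_pM2r ?exprn_gt0 //.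
  by rewrite -ler_pdivrMr // le_max lexx orbT.
Qed.

(* x / 0 = 0, so zeros of L far out would keep L (2 x) / L x away from 1. *)
Lemma tail_pos : exists A : R, forall x : R, A < x -> L x != 0.
Proof.
have : \forall x \near +oo, 0 < L (2 * x) / L x.
  by apply: (cvgr_gt (1 : R)) => //; apply: hL.
case=> A [_ h]; exists A => x /h; apply: contraTneq => ->.
by rewrite invr0 mulr0 ltxx.
Qed.

(** Otherwise all tails of [D] vanish, and so does [L] at every positive integer, against
    [tail_pos]. *)
Lemma prob_pos_gt0 : 0 < fine (P0 (D @^-1` [set k | (0 < k)%N])).
Proof.
have [A hA] := tail_pos.
have [k Ak] : exists k : nat, A < k.+1%:R.
  exists (Num.trunc `|A|); apply: le_lt_trans (ler_norm A) _.
  by rewrite truncnS_gt.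
have m0 := measurable_RV_nat D [set k | (0 < k)%N].
have mk := measurable_RV_nat D [set j | (k.+1 < j)%N].
rewrite fine_gt0 // ltey_eq fin_num_measure // andbT.
apply: (@lt_le_trans _ _ (P0 (D @^-1` [set j | (k.+1 < j)%N]))); last first.
  by apply: le_measure; rewrite ?inE // => w /=; exact: leq_trans.
rewrite lt_neqAle measure_ge0 andbT eq_sym /preimage /= hD // eqe.
by rewrite mulf_neq0 ?hA // powR_eq0 pnatr_eq0.
Qed.

Let u m : R := fine (P0 [set w | (2 ^ m < D w)%N]).

(* Ratio test along the powers of 2: u_(m+1) / u_m tends to 2^(- gamma). *)
Lemma tail_decay (s : R) : s < gamma -> exists C z : R,
  [/\ 0 <= C, 0 < z, z < 1 & forall m, (2 ^ m)%:R `^ s * u m <= C * z ^+ m].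
Proof.
(* Half of the gap [gamma - s] absorbs the deviation of L (2 x) / L x from 1; the other half leaves
   the ratio [z < 1]. *)
move=> sg; pose e := (gamma - s) / 2; have e0 : 0 < e by rewrite /e; lra.
pose z : R := 2 `^ (- e).
have z0 : 0 < z by rewrite powR_gt0.
have [A [_ hA]] : \forall x \near +oo, L (2 * x) / L x < 2 `^ e.
  apply: (cvgr_lt (1 : R)); first by apply: hL.
  by rewrite /powR pnatr_eq0 /= expR_gt1 mulr_gt0 ?ln_gt0 ?ltr1n.
have [B hB] := tail_pos.
have uE m : u m = L (2 ^ m)%:R * (2 ^ m)%:R `^ (- gamma).
  by rewrite /u hD ?expn_gt0.
have u0 m : 0 <= u m by rewrite fine_ge0.
have [N AN] : exists N : nat, Num.max A B < N%:R.
  exists (Num.trunc `|Num.max A B|).+1; apply: le_lt_trans (ler_norm _) _.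
  by rewrite truncnS_gt.
have [||C C0 hC] := @geometric_domination (fun m => (2 ^ m)%:R `^ s * u m) z N z0.
- by move=> m; rewrite mulr_ge0 ?powR_ge0.
- move=> m Nm; set x : R := (2 ^ m)%:R.
  have : Num.max A B < x.
    by apply: lt_le_trans AN _; rewrite ler_nat (leq_trans Nm) // ltnW // ltn_expl.
  rewrite gt_max => /andP[/hA + /hB Lx].
  have x0 : 0 < x by rewrite ltr0n expn_gt0.
  (* The sign of [L] comes from the tail probability, which is nonnegative at powers of 2. *)
  have Lx0 : 0 < L x.
    rewrite lt_neqAle eq_sym Lx /=; have := u0 m.
    by rewrite uE pmulr_lge0 // powR_gt0.
  rewrite ltr_pdivrMr // => /ltW le.
  rewrite !uE -/x expnS natrM -/x !powRM //.
  have -> : z = 2 `^ e * 2 `^ s * 2 `^ (- gamma).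
    by rewrite -!powRD ?pnatr_eq0 ?implybT //; congr (_ `^ _); rewrite /e; lra.
  have p1 : 0 <= 2 `^ s * x `^ s * (2 `^ (- gamma) * x `^ (- gamma)).
    by rewrite !mulr_ge0 ?powR_ge0.
  by have := ler_wpM2l p1 le; lra.
exists C, z; split => //.
by rewrite /z /powR pnatr_eq0 /= expR_lt1 mulNr oppr_lt0 mulr_gt0 ?ln_gt0 ?ltr1n.
Qed.

(** One term of the series suffices: if 2^m < k <= 2^(m+1), then k + 1 <= 4 * 2^m. The constant in
    front covers [k <= 1]. *)
Lemma powR_dyadic_le (k : nat) (s : R) : 0 <= s ->
  ((k.+1%:R `^ s)%:E <= (2 `^ s)%:E +
    \sum_(0 <= m <oo) (4 `^ s * (2 ^ m)%:R `^ s * (2 ^ m < k)%N%:R)%:E)%E.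
Proof.
move=> s0; have t0 m : (0 <= (4 `^ s * (2 ^ m)%:R `^ s * (2 ^ m < k)%N%:R : R)%:E)%E.
  by rewrite lee_fin !mulr_ge0 ?powR_ge0.
have [k1|k1] := leqP k 1.
  rewrite -[leLHS]adde0 leeD //; last by rewrite nneseries_ge0.
  by rewrite lee_fin ge0_ler_powR ?nnegrE // ler_nat ltnS.
have /andP[lo hi] := up_log_bounds (ltnSn 1) k1.
set m := (up_log 2 k).-1 in lo.
have Em : up_log 2 k = m.+1 by rewrite prednK // up_log_gt0.
rewrite -[leLHS]add0e leeD ?lee_fin ?powR_ge0 //.
apply: (le_trans _ (nneseries_lim_ge m.+1 _)) => [|? _ _]; last exact: t0.
rewrite big_nat_recr //= -[leLHS]add0e leeD ?sume_ge0 // lee_fin lo mulr1.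
rewrite -powRM // ge0_ler_powR ?nnegrE //.
rewrite -natrM ler_nat; move: hi; rewrite Em expnS => hi.
by rewrite (mulnDl 2 2) -addn1 leq_add // muln_gt0 expn_gt0.
Qed.

(** Integrating the dyadic bound termwise gives a series dominated by a geometric one through
    [tail_decay]. The shift [D + 1] leaves room for the parity correction. *)
Lemma moment_finite (s : R) : 0 <= s < gamma ->
  (\int[P0]_w (((D w).+1%:R : R) `^ s)%:E < +oo)%E.
Proof.
move=> /andP[s0 sg]; have [C [z [C0 z0 z1 hC]]] := tail_decay sg.
pose g m w : \bar R := (4 `^ s * (2 ^ m)%:R `^ s * (2 ^ m < D w)%N%:R)%:E.
have g0 m w : (0 <= g m w)%E by rewrite lee_fin !mulr_ge0 ?powR_ge0.
have mnat (f : nat -> \bar R) : measurable_fun setT (f \o D).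
  by move=> mT B mB; rewrite setTI; exact: (measurable_RV_nat D (f @^-1` B)).
have mg m : measurable_fun setT (g m).
  exact: (mnat (fun k => (4 `^ s * (2 ^ m)%:R `^ s * (2 ^ m < k)%N%:R)%:E)).
apply: (@le_lt_trans _ _ (\int[P0]_w ((2 `^ s)%:E + \sum_(0 <= m <oo) g m w))%E).
  apply: ge0_le_integral => //.
  - exact: (mnat (fun k => (k.+1%:R `^ s)%:E)).
  - by apply: emeasurable_funD => //; apply: ge0_emeasurable_sum.
  - by move=> w _; exact: powR_dyadic_le.
rewrite ge0_integralD //; last 2 first.
- by move=> w _; rewrite nneseries_ge0.
- exact: ge0_emeasurable_sum.
have -> : (\int[P0]__ (2 `^ s)%:E = (2 `^ s)%:E)%E.
  rewrite (integral_cst P0 measurableT) -[RHS]mule1; congr (_ * _)%E.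
  exact: probability_setT.
rewrite lte_add_pinfty ?ltry //.
rewrite integral_nneseries //.
apply: (@le_lt_trans _ _ (4 `^ s * C / (1 - z))%:E); last exact: ltry.
apply: lime_le; first by apply: is_cvg_nneseries => m _ _; exact: integral_ge0.
apply: nearW => k.
apply: (@le_trans _ _ (\sum_(0 <= m < k) (4 `^ s * (C * z ^+ m))%:E)%E).
  apply: lee_sum => m _.
  have -> : g m = fun w => ((4 `^ s * (2 ^ m)%:R `^ s)%:E *
      (\1_[set w | (2 ^ m < D w)%N] w)%:E)%E.
    apply/funext => w; rewrite /g indicE EFinM (_ : (w \in _) = (2 ^ m < D w)%N) //.
    by apply/idP/idP; rewrite inE.
  have mA : measurable [set w | (2 ^ m < D w)%N].
    exact: (measurable_RV_nat D [set k | (2 ^ m < k)%N]).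
  rewrite ge0_integralZl_EFin ?mulr_ge0 ?powR_ge0 //; last first.
    by apply/measurable_EFinP/measurable_indic.
  have um : P0 [set w | (2 ^ m < D w)%N] = (u m)%:E.
    by rewrite fineK // fin_num_measure.
  rewrite integral_indic // setIT.
  apply: (@le_trans _ _ ((4 `^ s * (2 ^ m)%:R `^ s)%:E * (u m)%:E)%E).
    by rewrite -um.
  rewrite -EFinM lee_fin.
  by rewrite -mulrA ler_wpM2l ?powR_ge0 //; exact: hC.
rewrite sumEFin lee_fin -mulr_sumr -mulrA ler_wpM2l ?powR_ge0 // -mulr_sumr.
rewrite ler_wpM2l // big_mkord -[leRHS]mul1r ler_pdivlMr ?subr_gt0 //.
by rewrite mulrC -opprB mulNr -subrX1 opprB gerBl exprn_ge0 // ltW.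
Qed.

End Moments.

(** * Powers of n and the deterministic estimate *)

Section RealBounds.
Context {R : realType}.

Lemma powR_opp_le (a x y : R) : 0 <= a -> 0 < x -> x <= y -> y `^ (- a) <= x `^ (- a).
Proof.
move=> a0 x0 xy; have y0 := lt_le_trans x0 xy.
by rewrite !powRN lef_pV2 ?posrE ?powR_gt0 // ge0_ler_powR ?nnegrE ?(ltW x0) ?(ltW y0).
Qed.

Lemma cvg_natr_powR_opp (a : R) : 0 < a -> n%:R `^ (- a) @[n --> \oo] --> (0 : R).
Proof.
move=> a0; apply/cvgrPdist_le => e e0; near=> n.
rewrite sub0r normrN ger0_norm ?powR_ge0 // powRN.
have n0 : 0 < n%:R :> R by rewrite ltr0n; near: n; exact: nbhs_infty_gt.
rewrite invf_ple ?posrE ?powR_gt0 //.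
have -> : e^-1 = (e^-1 `^ a^-1) `^ a by rewrite -powRrM mulVf ?gt_eqF // powRr1 // invr_ge0 ltW.
rewrite ge0_ler_powR ?nnegrE ?powR_ge0 ?(ltW a0) ?(ltW n0) //.
by near: n; exact: nbhs_infty_ger.
Unshelve. all: by end_near. Qed.

(** Both terms decrease in [l] and increase in [S]. Inserting [c * x] and x^(1 + eta) yields the
    exponents 1 - s + eta and 1 - s + 2 eta, and [x >= 1] allows the larger one for both. *)
Lemma removed_bound_le (x c l S s eta : R) : 0 < c -> 1 <= x -> 0 <= s ->
  0 <= eta -> c * x <= l -> 0 <= S <= x `^ (1 + eta) ->
  l^-1 * (2 * l `^ (1 - s) * S + 8 * l `^ (- s) * S ^+ 2) <=
  (2 * c `^ (- s) + 8 * c `^ (- (1 + s))) * x `^ (1 - s + 2 * eta).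
Proof.
move=> c0 x1 s0 eta0 cxl /andP[S0 Sx]; have x0 : 0 < x by lra.
have cx0 : 0 < c * x by rewrite mulr_gt0.
have l0 : 0 < l by lra.
have pne (y a b : R) : 0 < y -> (a + b == 0) ==> (y != 0).
  by move=> y0; rewrite (gt_eqF y0) implybT.
have -> : l^-1 * (2 * l `^ (1 - s) * S + 8 * l `^ (- s) * S ^+ 2) =
  2 * (l `^ (- s) * S) + 8 * (l `^ (- (1 + s)) * S ^+ 2).
  have -> : l `^ (1 - s) = l * l `^ (- s) by rewrite powRD ?pne // powRr1 // ltW.
  have -> : l `^ (- (1 + s)) = l^-1 * l `^ (- s).
    by rewrite opprD powRD ?pne // powR_inv1 // ltW.
  by rewrite mulrDr !mulrA; congr (_ + _); [rewrite mulrAC|]; field; rewrite gt_eqF.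
rewrite [leRHS]mulrDl -!mulrA lerD // ler_pM2l //.
  apply: (@le_trans _ _ ((c * x) `^ (- s) * x `^ (1 + eta))).
    by rewrite ler_pM ?powR_ge0 // powR_opp_le.
  rewrite powRM ?(ltW c0) ?(ltW x0) // -mulrA ler_pM2l ?powR_gt0 //.
  by rewrite -powRD ?pne // ler_powR //; lra.
apply: (@le_trans _ _ ((c * x) `^ (- (1 + s)) * (x `^ (1 + eta)) ^+ 2)).
  by rewrite ler_pM ?powR_ge0 ?sqr_ge0 ?powR_opp_le ?lerXn2r ?nnegrE ?powR_ge0 //; lra.
rewrite powRM ?(ltW c0) ?(ltW x0) // -mulrA ler_pM2l ?powR_gt0 //.
by rewrite -powR_mulrn ?powR_ge0 // -powRrM -powRD ?pne // ler_powR //; lra.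
Qed.

End RealBounds.

(** * Moment sums and measurability in the configuration model *)

Section Model.
Context {R : realType} {d0 d : measure_display} {T0 : measurableType d0}.
Context {T : measurableType d}.
Variables (P0 : probability T0 R) (D : {RV P0 >-> nat}).
Variables (P : probability T R) (n : nat) (X : 'I_n -> {RV P >-> nat}).
Variable G : T -> configuration n.
Hypothesis hG : configuration_model D X G.

(** The shifted samples are identically distributed and dominate the degrees after the parity
    correction. *)
Definition moment_sum (s : R) (w : T) : R := \sum_(i < n) ((X i w).+1%:R : R) `^ s.

Lemma degrees_bounds w i : (X i w <= degrees (G w) i <= (X i w).+1)%N.
Proof.
rewrite (cm_degrees hG) !ffunE leq_addr -[leqRHS]addn1 leq_add2l.
exact: leq_b1.
Qed.

Lemma positive_nodes_le w : (#|positive_nodes X w| <= degree_sum (degrees (G w)))%N.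
Proof.
rewrite -sum1_card [leqLHS]big_mkcond /=; apply: leq_sum => i _.
by have /andP[h _] := degrees_bounds w i; rewrite inE; case: ltnP h => // h /(leq_trans h).
Qed.

Lemma degrees_moment_le s w : 0 <= s ->
  \sum_(i < n) ((degrees (G w) i)%:R : R) `^ s <= moment_sum s w.
Proof.
move=> s0; apply: ler_sum => i _; rewrite ge0_ler_powR ?nnegrE // ler_nat.
by case/andP: (degrees_bounds w i).
Qed.

Lemma measurable_moment_sum s : measurable_fun setT (moment_sum s).
Proof.
apply: measurable_sum => i mT B mB; rewrite setTI.
exact: (measurable_RV_nat (X i) ((fun k => (k.+1%:R : R) `^ s) @^-1` B)).
Qed.

Lemma measurable_moment_sum_gt s t : measurable [set w | t < moment_sum s w].
Proof.
have := measurable_fun_ltr (measurable_cst t) (measurable_moment_sum s).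
by move=> /(_ measurableT [set true]); rewrite setTI; apply.
Qed.

Lemma integral_moment_sum s : (\int[P]_w (moment_sum s w)%:E =
  n%:R%:E * \int[P0]_w (((D w).+1%:R : R) `^ s)%:E)%E.
Proof.
have mnat (f : nat -> \bar R) : measurable_fun setT f by [].
have mf i : measurable_fun setT (fun w => (((X i w).+1%:R : R) `^ s)%:E).
  move=> mT B mB; rewrite setTI.
  exact: (measurable_RV_nat (X i) ((fun k => ((k.+1%:R : R) `^ s)%:E) @^-1` B)).
under eq_integral do rewrite /moment_sum -sumEFin.
rewrite ge0_integral_sum //.
rewrite (eq_bigr (fun=> \int[P0]_w (((D w).+1%:R : R) `^ s)%:E)%E) => [|i _].
  by rewrite sumr_const card_ord mule_natl.
pose f k : \bar R := ((k.+1%:R : R) `^ s)%:E.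
have f0 k : (0 <= f k)%E by rewrite lee_fin powR_ge0.
rewrite -(ge0_integral_distribution (X i) (mnat f) f0).
rewrite -(ge0_integral_distribution D (mnat f) f0).
by apply: eq_measure_integral => A mA _; exact: (cm_iid hG).2.
Qed.

(** Markov's inequality, in product form because the moment may still be infinite here. *)
Lemma prob_large_moment_sum s t : 0 < t ->
  (t%:E * P [set w | (t < moment_sum s w)%R] <=
   n%:R%:E * \int[P0]_w (((D w).+1%:R : R) `^ s)%:E)%E.
Proof.
move=> t0; rewrite -integral_moment_sum.
have mS := measurable_moment_sum s.
have mA := measurable_moment_sum_gt s t.
have mI : measurable_fun setT (fun w => (\1_[set w | t < moment_sum s w] w : R)%:E).
  exact/measurable_EFinP/measurable_indic.
have S0 w : 0 <= moment_sum s w by apply: sumr_ge0 => i _; exact: powR_ge0.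
have -> : (t%:E * P [set w | (t < moment_sum s w)%R] =
    \int[P]_w (t%:E * (\1_[set w | (t < moment_sum s w)%R] w)%:E))%E.
  by rewrite ge0_integralZl_EFin ?ltW // integral_indic // setIT.
apply: ge0_le_integral => //.
- by move=> w _; rewrite mule_ge0 // lee_fin ltW.
- exact: measurable_funeM.
- exact/measurable_EFinP.
- move=> w _; rewrite -EFinM lee_fin indicE; case: (boolP (w \in _)); last by rewrite mulr0.
  by rewrite inE /= mulr1 => /ltW.
Qed.

(** The variable depends on [w] only through the degree sequence, so the preimage is a countable
    union of whole fibres of that sequence. *)
Lemma measurable_mean_removed (B : set R) : measurable (mean_removed P G @^-1` B).
Proof.
pose F (dd : {ffun 'I_n -> nat}) :=
  [set w | degrees (G w) = dd] `&` (mean_removed P G @^-1` B).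
have -> : mean_removed P G @^-1` B = \bigcup_dd F dd.
  by apply/seteqP; split=> [w Bw|w [dd _ []]] //; exists (degrees (G w)).
apply: countable_bigcupT_measurable => // dd.
have [[w0 [w0d Bw0]]|none] := pselect (exists w, F dd w); last first.
  by rewrite (_ : F dd = set0) //; apply/seteqP; split=> // w Fw; apply: none; exists w.
rewrite (_ : F dd = [set w | degrees (G w) = dd]); first exact: measurable_degrees_fiber (cm_measurable hG) _.
apply/seteqP; split=> [w []|w /= wd] //; split=> //=.
suff -> : mean_removed P G w = mean_removed P G w0 by [].
by rewrite /mean_removed /cond_expectation wd w0d.
Qed.

End Model.

(** * Convergence in probability *)

Section Asymptotics.
Context {R : realType} (gamma : R) (L : R -> R).
Hypothesis hL : slowly_varying L.
Context {d0 : measure_display} {T0 : measurableType d0} {P0 : probability T0 R}.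
Context {D : {RV P0 >-> nat}}.
Hypothesis hD : forall k : nat, (0 < k)%N ->
  P0 [set w | (k < D w)%N] = (L k%:R * k%:R `^ (- gamma))%:E.
Context {d : nat -> measure_display} {T : forall n : nat, measurableType (d n)}.
Context {P : forall n : nat, probability (T n) R}.
Context {X : forall n : nat, 'I_n -> {RV (P n) >-> nat}}.
Context {G : forall n : nat, T n -> configuration n}.
Arguments X : clear implicits.
Arguments G : clear implicits.
Hypothesis hG : forall n : nat, configuration_model D (X n) (G n).

Let p : R := fine (P0 (D @^-1` [set k | (0 < k)%N])).
Let mu (s : R) : R := fine (\int[P0]_w (((D w).+1%:R : R) `^ s)%:E).

Lemma prob_bad_le (s eta : R) (n : nat) : 0 <= s < gamma -> (0 < n)%N ->
  (P n ([set w | (#|positive_nodes (X n) w|%:R <= n%:R * p / 4)%R] `|`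
        [set w | (n%:R `^ (1 + eta) < moment_sum (X n) s w)%R]) <=
   ((p / 4)^-1 * n%:R `^ (- 1) + mu s * n%:R `^ (- eta))%:E)%E.
Proof.
move=> sg n0; have n0' : 0 < n%:R :> R by rewrite ltr0n.
have p0 : 0 < p := prob_pos_gt0 hL hD.
have m1 : measurable [set w | #|positive_nodes (X n) w|%:R <= n%:R * p / 4].
  exact: (measurable_positive_nodes_fiber (X n) [set A : {set 'I_n} | #|A|%:R <= n%:R * p / 4]).
have m2 : measurable [set w | n%:R `^ (1 + eta) < moment_sum (X n) s w].
  exact: measurable_moment_sum_gt.
apply: (le_trans (measureU2 (P n) m1 m2)); rewrite EFinD leeD //.
  apply: le_trans (prob_few_positive_nodes (cm_iid (hG n))) _.
  (* The exponential bound is weakened by e^(-y) <= 1/y with y = n p / 4. *)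
  rewrite lee_fin -/p powR_inv1 ?(ltW n0') // -invfM expRN lef_pV2 ?posrE ?expR_gt0 ?mulr_gt0 //.
  have -> : p / 4 * n%:R = n%:R * p / 4 by rewrite mulrC mulrA.
  by apply: le_trans (expR_ge1Dx _); rewrite lerDr.
have t0 : 0 < n%:R `^ (1 + eta) :> R by rewrite powR_gt0.
have := prob_large_moment_sum (hG n) s t0.
have -> : (\int[P0]_w (((D w).+1%:R : R) `^ s)%:E = (mu s)%:E)%E.
  rewrite fineK // ge0_fin_numE ?(moment_finite hL hD) //.
  by apply: integral_ge0 => w _; rewrite lee_fin powR_ge0.
rewrite -lee_pdivlMl // => /le_trans; apply.
rewrite -!EFinM lee_fin mulrCA mulrA [leRHS]mulrC ler_wpM2r //.
  by apply: fine_ge0; apply: integral_ge0 => w _; rewrite lee_fin powR_ge0.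
have -> : n%:R `^ (1 + eta) = n%:R * n%:R `^ eta :> R.
  by rewrite powRD ?powRr1 ?ltW // (gt_eqF n0') implybT.
by rewrite invfM mulrA divff ?gt_eqF // mul1r powRN.
Qed.

Lemma mean_removed_bigO (s rho : R) : 1 <= s <= 2 -> s < gamma ->
  forall eps, 1 - s < rho + eps ->
  cvg_prob0 P (fun n w => (n%:R : R) `^ (- rho - eps) * mean_removed (P n) (G n) w).
Proof.
move=> s12 sg eps re delta delta0; have [s1 s2] := andP s12.
have s0 : 0 <= s by lra.
(* [kappa] is the spare exponent. With [eta = kappa / 4] the final power of n is - kappa + 2 eta = -
   2 eta, which tends to 0. *)
pose kappa := rho + eps - (1 - s); have k0 : 0 < kappa by rewrite /kappa; lra.
pose eta := kappa / 4; have eta0 : 0 < eta by rewrite /eta; lra.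
have p0 : 0 < p := prob_pos_gt0 hL hD.
have c0 : 0 < p / 4 by lra.
pose C := 2 * (p / 4) `^ (- s) + 8 * (p / 4) `^ (- (1 + s)).
pose bad n := [set w | (#|positive_nodes (X n) w|%:R <= n%:R * p / 4)%R] `|`
        [set w | (n%:R `^ (1 + eta) < moment_sum (X n) s w)%R].
apply: (@squeeze_cvge _ _ _ _ (fun=> 0%E) _ (fun n => ((p / 4)^-1 * n%:R `^ (- 1) + mu s * n%:R `^ (- eta))%:E)).
- have small : \forall n \near \oo, C * n%:R `^ (- (2 * eta)) <= delta.
    have : C * n%:R `^ (- (2 * eta)) @[n --> \oo] --> C * 0.
      by apply: cvgMr; apply: cvg_natr_powR_opp; lra.
    by rewrite mulr0 => /cvgr_le; apply.
  near=> n.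
  have n0 : (0 < n)%N by near: n; exact: nbhs_infty_gt.
  have n1 : 1 <= n%:R :> R by rewrite ler1n.
  rewrite measure_ge0 /=; apply: le_trans (prob_bad_le _ _ n0); last by rewrite s0.
  apply: le_measure; rewrite ?inE.
  + exact: (measurable_mean_removed (hG n) [set y | delta < `|n%:R `^ (- rho - eps) * y|]).
  + apply: measurableU; last exact: measurable_moment_sum_gt.
    exact: (measurable_positive_nodes_fiber (X n) [set A : {set 'I_n} | #|A|%:R <= n%:R * p / 4]).
  (* Off the bad event the deterministic bound applies and keeps the scaled mean below [delta]. *)
  move=> w /=; apply: contraPP => /not_orP[/negP + /negP].
  rewrite -ltNge -leNgt => Nw Sw; apply/negP; rewrite -leNgt.
  have Nl : p / 4 * n%:R <= (degree_sum (degrees (G n w)))%:R.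
    have := positive_nodes_le (hG n) w; rewrite -(ler_nat R); apply: le_trans.
    by rewrite mulrC mulrA ltW.
  have l4 : (4 <= degree_sum (degrees (G n w)))%N.
    rewrite -(ler_nat R); apply: le_trans Nl.
    rewrite mulrC -ler_pdivrMr //; near: n; exact: nbhs_infty_ger.
  have m0 := mean_removed_ge0 (cm_measurable (hG n)) (cm_uniform (hG n)) w.
  rewrite ger0_norm; last exact: mulr_ge0 (powR_ge0 _ _) m0.
  have := mean_removed_le (cm_measurable (hG n)) (cm_uniform (hG n)) l4 s12.
  have Sd : 0 <= \sum_(i < n) ((degrees (G n w) i)%:R : R) `^ s <= n%:R `^ (1 + eta).
    rewrite sumr_ge0 => [|i _]; last exact: powR_ge0.
    exact: le_trans (degrees_moment_le (hG n) w s0) Sw.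
  move/le_trans/(_ (removed_bound_le c0 n1 s0 (ltW eta0) Nl Sd)).
  move=> /(ler_wpM2l (powR_ge0 n%:R (- rho - eps)))/le_trans; apply.
  have -> : n%:R `^ (- rho - eps) * (C * n%:R `^ (1 - s + 2 * eta)) = C * n%:R `^ (- (2 * eta)).
    rewrite mulrCA -powRD; last by rewrite pnatr_eq0 -lt0n n0 implybT.
    by congr (_ * _ `^ _); rewrite /eta /kappa; lra.
  by near: n; exact: small.
- exact: cvg_cst.
- apply/cvg_EFin; first by apply: nearW.
  rewrite -[0](_ : (p / 4)^-1 * 0 + mu s * 0 = 0); last by rewrite !mulr0 addr0.
  by apply: cvgD; apply: cvgMr; apply: cvg_natr_powR_opp.
Unshelve. all: by end_near. Qed.

End Asymptotics.

Theorem theorem1 (R : realType) (gamma : R) (hgamma : 1 < gamma)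
  (L : R -> R) (hL : slowly_varying L)
  (d0 : measure_display) (T0 : measurableType d0) (P0 : probability T0 R)
  (D : {RV P0 >-> nat})
  (hD : forall k : nat, (0 < k)%N ->
     P0 [set w | (k < D w)%N] = (L k%:R * k%:R `^ (- gamma))%:E)
  (d : nat -> measure_display) (T : forall n : nat, measurableType (d n))
  (P : forall n : nat, probability (T n) R)
  (X : forall n : nat, 'I_n -> {RV (P n) >-> nat})
  (G : forall n : nat, T n -> configuration n)
  (hG : forall n : nat, configuration_model D (X n) (G n)) :
  [/\ 1 < gamma <= 3 / 2 ->
        bigO_prob P (fun n => mean_removed (P n) (G n)) (1 / gamma - 1),
      3 / 2 < gamma <= 2 ->
        bigO_prob P (fun n => mean_removed (P n) (G n)) (4 / gamma - 3) &
      2 < gamma ->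
        bigO_prob P (fun n => mean_removed (P n) (G n)) (-1)].

Proof.
have bigO (rho : R) : (forall eps, 0 < eps -> exists s, [/\ 1 <= s <= 2, s < gamma & 1 - s < rho + eps]) ->
    bigO_prob P (fun n => mean_removed (P n) (G n)) rho.
  move=> h eps eps0; have [s [s12 sg re]] := h _ eps0.
  exact: (mean_removed_bigO hL hD hG s12 sg).
have bigO_le2 (rho : R) : gamma <= 2 -> 1 - gamma <= rho ->
    bigO_prob P (fun n => mean_removed (P n) (G n)) rho.
  move=> g2 gr; apply: bigO => eps eps0.
  (* Capping [eps] by [gamma - 1] keeps s = gamma - m / 2 above 1, while 1 - s exceeds 1 - gamma by
     only m / 2 < eps. *)
  pose m := Num.min eps (gamma - 1).
  have m0 : 0 < m by rewrite lt_min eps0 subr_gt0.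
  have me : m <= eps by rewrite ge_min lexx.
  have mg : m <= gamma - 1 by rewrite ge_min lexx orbT.
  by exists (gamma - m / 2); split; lra.
have g0 : gamma != 0 by rewrite gt_eqF //; lra.
split=> [/andP[_ g32]|/andP[_ g2]|g2].
- apply: bigO_le2; first by lra.
  (* Multiplied by [gamma], the claim becomes (gamma - 1)^2 >= 0. *)
  rewrite -(ler_pM2l (_ : 0 < gamma)); last by lra.
  by rewrite [leRHS]mulrBr (mulrC gamma (_ / _)) divfK //; nra.
- apply: bigO_le2 => //.
  (* Here it becomes (gamma - 2)^2 >= 0. *)
  rewrite -(ler_pM2l (_ : 0 < gamma)); last by lra.
  by rewrite [leRHS]mulrBr (mulrC gamma (_ / _)) divfK //; nra.
- by apply: bigO => eps eps0; exists 2; split; lra.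
Qed.
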